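(* For any integer $N\ge2$, the metric space $\big(\mathcal{P}_2(\mathbb{R}),\mathcal{Q}_{N,2}\big)$ is not complete.
   Context: $\mathcal{P}_2(\mathbb{R})$ is the set of Borel probability measures on $\mathbb{R}$ with finite second moment. For $\mu\in\mathcal{P}_2(\mathbb{R})$ and $(x_1,\dots,x_N)\in\mathbb{R}^N$, $e_{N,2}(\mu,(x_1,\dots,x_N))=\big[\int_{\mathbb{R}}\min_{1\le i\le N}|\xi-x_i|^2\,\mu(d\xi)\big]^{1/2}$, and $\mathcal{Q}_{N,2}(\mu,\nu)=\sup_{x\in\mathbb{R}^N}|e_{N,2}(\mu,x)-e_{N,2}(\nu,x)|$, which is a distance on $\mathcal{P}_2(\mathbb{R})$ for $N\ge2$. *)

(* Defs.v *)
From HB Require Import structures.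
From mathcomp Require Import all_boot all_order all_algebra.
From mathcomp Require Import ring lra.
From mathcomp Require Import all_classical all_reals all_analysis.
From mathcomp Require Import measurable_realfun.

Set Implicit Arguments.
Unset Strict Implicit.
Unset Printing Implicit Defensive.

Import Order.TTheory GRing.Theory Num.Theory.
Import numFieldNormedType.Exports.

Local Open Scope classical_set_scope.
Local Open Scope ring_scope.

(* A [probability] of the library is a function on all sets, unconstrained
   outside the sigma-algebra.  [P2_nonmeas] pins it to 0 there, so that
   Leibniz equality on [P2 R] is equality of Borel measures. *)
Record P2 (R : realType) := MkP2 {
  P2_prob :> probability (measurableTypeR R) R ;
  P2_nonmeas : forall A : set (measurableTypeR R),
    ~ measurable A -> P2_prob A = 0%E ;
  P2_moment : (\int[P2_prob]_xi (xi ^+ 2)%:E < +oo)%E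
}.

Definition quant_err (R : realType) (N : nat) (mu : P2 R) (x : 'rV[R]_N) : R :=
  Num.sqrt (fine
    (\int[mu]_xi \big[Order.min/+oo%E]_(i < N) ((`|xi - x 0 i| ^+ 2)%:E))%E).

Definition quant_dist (R : realType) (N : nat) (mu nu : P2 R) : R :=
  sup [set `|quant_err mu x - quant_err nu x| | x in [set: 'rV[R]_N]].

Section facts.
Context {R : realType}.
Implicit Types (mu nu : P2 R).
Local Notation T := (measurableTypeR R).

Let mind N (x : 'rV[R]_N) (xi : R) : \bar R :=
  \big[Order.min/+oo%E]_(i < N) ((`|xi - x 0 i| ^+ 2)%:E).

Let mind_ge0 N (x : 'rV[R]_N) xi : (0 <= mind x xi)%E.
Proof.
rewrite /mind; elim/big_ind: _ => [//|a b a0 b0|i _].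
  by rewrite le_min a0 b0.
by rewrite lee_fin sqr_ge0.
Qed.

Let mind_le N (x : 'rV[R]_N) xi i : (mind x xi <= (`|xi - x ord0 i| ^+ 2)%:E)%E.
Proof. by rewrite /mind (bigD1 i)//= ge_min lexx. Qed.


Let mind_ex N (x : 'rV[R]_N) xi : (0 < N)%N ->
  exists i, mind x xi = (`|xi - x ord0 i| ^+ 2)%:E.
Proof.
move=> N0; have /orP[|/existsP[i /eqP]] : (mind x xi == +oo)%E ||
    [exists i, mind x xi == (`|xi - x ord0 i| ^+ 2)%:E].
- rewrite /mind; elim/big_rec: _ => [|i y _ IH]; first by rewrite eqxx.
  rewrite minEle; case: ifP => // _; apply/orP; right.
  by apply/existsP; exists i; rewrite eqxx.
- move=> /eqP E; have := mind_le x xi (Ordinal N0).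
  by rewrite E leye_eq.
- by move=> E; exists i.
Qed.

Let mind_meas N (x : 'rV[R]_N) : measurable_fun [set: T] (mind x).
Proof.
rewrite /mind.
suff H (s : seq 'I_N) : measurable_fun [set: T] (fun xi : R =>
  \big[Order.min/+oo%E]_(i <- s) ((`|xi - x 0 i| ^+ 2)%:E)) by exact: H.
elim: s => [|i s IH].
  by under eq_fun do rewrite big_nil; exact: measurable_cst.
under eq_fun do rewrite big_cons.
apply: measurable_mine => //; apply/measurable_EFinP.
apply: measurable_funX; apply: measurableT_comp => //.
exact: measurable_funB.
Qed.

Let m2 mu := fine (\int[mu]_xi (xi ^+ 2)%:E).

Let m2E mu : (\int[mu]_xi (xi ^+ 2)%:E = (m2 mu)%:E)%E.
Proof.
rewrite fineK// ge0_fin_numE ?P2_moment//.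
by apply: integral_ge0 => xi _; rewrite lee_fin sqr_ge0.
Qed.

Let m2_ge0 mu : 0 <= m2 mu.
Proof. by rewrite fine_ge0// integral_ge0 => // xi _; rewrite lee_fin sqr_ge0. Qed.

Let int_quad mu (a b : R) : 0 <= a -> 0 <= b ->
  (\int[mu]_xi (a + b * xi ^+ 2)%:E = (a + b * m2 mu)%:E)%E.
Proof.
move=> a0 b0; under eq_integral do rewrite EFinD.
rewrite ge0_integralD//=.
- rewrite integral_cst//= probability_setT mule1.
  under eq_integral do rewrite EFinM.
  rewrite ge0_integralZl_EFin//; first by rewrite m2E -EFinM -EFinD.
  + by move=> xi _; rewrite lee_fin sqr_ge0.
  + by apply/measurable_EFinP; exact: measurable_funX.
- by move=> xi _; rewrite lee_fin mulr_ge0// sqr_ge0.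
- by apply/measurable_EFinP; apply: measurable_funM => //; exact: measurable_funX.
Qed.

Let quad_meas (a b : R) :
  measurable_fun [set: T] (fun xi : R => (a + b * xi ^+ 2)%:E).
Proof.
apply/measurable_EFinP; apply: measurable_funD => //.
by apply: measurable_funM => //; exact: measurable_funX.
Qed.

Let sq_err N mu (x : 'rV[R]_N) : (0 < N)%N ->
  (\int[mu]_xi mind x xi = (quant_err mu x ^+ 2)%:E)%E.
Proof.
move=> N0; have I0 : (0 <= \int[mu]_xi mind x xi)%E.
  by apply: integral_ge0 => xi _; exact: mind_ge0.
rewrite sqr_sqrtr ?fine_ge0// fineK// ge0_fin_numE//.
pose i := Ordinal N0.
apply: (@le_lt_trans _ _ (\int[mu]_xi (2 * x ord0 i ^+ 2 + 2 * xi ^+ 2)%:E)%E).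
  apply: ge0_le_integral; [exact: measurableT|by move=> xi _; exact: mind_ge0
    |exact: mind_meas|exact: quad_meas|move=> xi _].
  apply: le_trans (mind_le x xi i) _; rewrite lee_fin real_normK ?num_real//.
  have := sqr_ge0 (xi + x ord0 i); nra.
by rewrite int_quad ?ltry// mulr_ge0// sqr_ge0.
Qed.

Let err_bound N (x : 'rV[R]_N) : (0 < N)%N ->
  exists c, forall mu, `|quant_err mu x - c| <= 1 + m2 mu.
Proof.
move=> N0; have [i Ei] := mind_ex x 0 N0.
exists `|x ord0 i| => mu; set c := `|x ord0 i|.
have c0 : 0 <= c by exact: normr_ge0.
have cE : (x ord0 i) ^+ 2 = c ^+ 2 by rewrite real_normK ?num_real.
have e0 : 0 <= quant_err mu x by exact: sqrtr_ge0.
have up : quant_err mu x ^+ 2 <= (c ^+ 2 + c) + (c + 1) * m2 mu.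
  rewrite -lee_fin -sq_err// -int_quad ?addr_ge0 ?sqr_ge0//.
  apply: ge0_le_integral; [exact: measurableT|by move=> xi _; exact: mind_ge0
    |exact: mind_meas|exact: quad_meas|move=> xi _].
  apply: le_trans (mind_le x xi i) _; rewrite lee_fin real_normK ?num_real//.
  have /ler_normlP[] : `|xi * x ord0 i| <= (1 + xi ^+ 2) / 2 * c.
    rewrite normrM ler_wpM2r//.
    have := sqr_ge0 (`|xi| - 1); rewrite sqrrB real_normK ?num_real//; lra.
  nra.
have lo : c ^+ 2 <= quant_err mu x ^+ 2 + (c + c * m2 mu).
  have : (\int[mu]_xi (c ^+ 2 + 0 * xi ^+ 2)%:E <=
     \int[mu]_xi (mind x xi + (c + c * xi ^+ 2)%:E))%E.
    apply: ge0_le_integral; [exact: measurableT| |exact: quad_meas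
      |by apply: emeasurable_funD; [exact: mind_meas|exact: quad_meas]|].
      by move=> xi _; rewrite lee_fin mul0r addr0 sqr_ge0.
    move=> xi _; have [j ->] := mind_ex x xi N0.
    rewrite -EFinD lee_fin mul0r addr0.
    have cj : c <= `|x ord0 j|.
      have := mind_le x 0 j; rewrite Ei lee_fin !sub0r !normrN.
      by rewrite ler_pXn2r// nnegrE.
    have h1 : c * (2 * `|xi|) <= c * (1 + xi ^+ 2).
      rewrite ler_wpM2l//.
      have := sqr_ge0 (`|xi| - 1); rewrite sqrrB real_normK ?num_real//; lra.
    have h2 : c - `|xi| <= `|xi - x ord0 j|.
      by rewrite distrC; apply: le_trans (lerB_dist _ _); rewrite lerD2r.
    have [h|h] := leP `|xi| c; last first.
      by have := sqr_ge0 (`|xi - x ord0 j|); nra.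
    have : (c - `|xi|) ^+ 2 <= `|xi - x ord0 j| ^+ 2.
      by rewrite ler_pXn2r// nnegrE// subr_ge0.
    rewrite -(real_normK (num_real xi)) in h1 *.
    have := sqr_ge0 (`|xi|); nra.
  rewrite int_quad ?sqr_ge0// mul0r addr0 ge0_integralD; last 5 first.
  - exact: measurableT.
  - by move=> xi _; exact: mind_ge0.
  - exact: mind_meas.
  - by move=> xi _; rewrite lee_fin addr_ge0// mulr_ge0// sqr_ge0.
  - exact: quad_meas.
  by rewrite int_quad// sq_err// -EFinD lee_fin.
have := m2_ge0 mu; set e := quant_err _ _ in e0 up lo *; set m := m2 mu in up lo * => m0.
rewrite ler_distlC; apply/andP; split; nra.
Qed.

Let err_ubound N mu nu : (0 < N)%N ->
  has_ubound [set `|quant_err mu x - quant_err nu x| | x in [set: 'rV[R]_N]].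
Proof.
move=> N0; exists ((1 + m2 mu) + (1 + m2 nu)) => _ [x _ <-].
have [c hc] := err_bound x N0.
by rewrite (le_trans (ler_distD c _ _))// lerD ?hc// distrC hc.
Qed.

Lemma quant_dist_ub N mu nu (x : 'rV[R]_N) : (0 < N)%N ->
  `|quant_err mu x - quant_err nu x| <= quant_dist N mu nu.
Proof. by move=> N0; apply: ub_le_sup; [exact: err_ubound|exists x]. Qed.

Lemma quant_dist_le N mu nu (M : R) :
  (forall x : 'rV[R]_N, `|quant_err mu x - quant_err nu x| <= M) ->
  quant_dist N mu nu <= M.
Proof.
move=> h; apply: ge_sup; first by exists `|quant_err mu (0 : 'rV[R]_N) - quant_err nu (0 : 'rV[R]_N)|, 0.
by move=> _ [x _ <-].
Qed.

Lemma quant_distxx N mu : quant_dist N mu mu = 0.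
Proof.
rewrite /quant_dist (_ : image _ _ = [set 0]) ?sup1//.
by apply/seteqP; split=> [_ [x _ <-]|_ ->]; [|exists 0 => //]; rewrite subrr normr0.
Qed.

Lemma quant_dist_sym N mu nu : quant_dist N mu nu = quant_dist N nu mu.
Proof.
congr sup; apply/seteqP.
by split=> _ [x _ <-]; exists x => //; rewrite distrC.
Qed.

Lemma quant_dist_triangle N : (0 < N)%N -> forall nu mu la,
  quant_dist N mu la <= quant_dist N mu nu + quant_dist N nu la.
Proof.
move=> N0 nu mu la; apply: quant_dist_le => x.
by rewrite (le_trans (ler_distD (quant_err nu x) _ _))// lerD// quant_dist_ub.
Qed.


Let pp (m xi : R) : R := Num.max (xi - m) 0.

Let pp_ge0 m xi : 0 <= pp m xi. Proof. by rewrite /pp le_max lexx orbT. Qed.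

Let pp_meas m : measurable_fun [set: T] (fun xi : R => (pp m xi)%:E).
Proof.
apply/measurable_EFinP; rewrite /pp; apply: measurable_maxr => //.
exact: measurable_funB.
Qed.

Let pp_fin mu m : (\int[mu]_xi (pp m xi)%:E)%E \is a fin_num.
Proof.
rewrite ge0_fin_numE; last by apply: integral_ge0 => xi _; rewrite lee_fin.
apply: (@le_lt_trans _ _ (\int[mu]_xi ((1 + m ^+ 2) + 1 * xi ^+ 2)%:E)%E); last first.
  by rewrite int_quad ?ltry// addr_ge0// sqr_ge0.
apply: ge0_le_integral; [exact: measurableT|by move=> xi _; rewrite lee_fin
  |exact: pp_meas|exact: quad_meas|move=> xi _].
rewrite lee_fin /pp ge_max; apply/andP; split.
  by have := sqr_ge0 (xi - 1); have := sqr_ge0 (m + 1); nra.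
by have := sqr_ge0 xi; have := sqr_ge0 m; nra.
Qed.

Let pp_eq N mu nu m : (1 < N)%N ->
  (forall x : 'rV[R]_N, quant_err mu x = quant_err nu x) ->
  (\int[mu]_xi (pp m xi)%:E = \int[nu]_xi (pp m xi)%:E)%E.
Proof.
move=> N1 e; have N0 : (0 < N)%N by exact: ltnW.
pose a := m - 4^-1; pose b := m + 4^-1.
pose x1 : 'rV[R]_N := \row__ a.
pose x2 : 'rV[R]_N := \row_i (if i == Ordinal N0 then a else b).
have key xi : mind x1 xi = (mind x2 xi + (pp m xi)%:E)%E.
  have [i ->] := mind_ex x1 xi N0; rewrite mxE.
  have := mind_le x2 xi (Ordinal N0); have := mind_le x2 xi (Ordinal N1).
  have [j ->] := mind_ex x2 xi N0; rewrite !lee_fin -EFinD !mxE eqxx.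
  have -> : (Ordinal N1 == Ordinal N0) = false by [].
  rewrite !real_normK ?num_real//.
  have E : (xi - a) ^+ 2 = (xi - b) ^+ 2 + (xi - m) by rewrite /a /b; field.
  move=> h1 h2; congr EFin; move: h1 h2; rewrite /pp.
  by case: (j == _) => /= h1 h2; rewrite ?E /Num.max; case: ltP => h; lra.
have split_int (la : P2 R) : (\int[la]_xi mind x1 xi =
    \int[la]_xi mind x2 xi + \int[la]_xi (pp m xi)%:E)%E.
  rewrite -ge0_integralD; last 5 first.
  - exact: measurableT.
  - by move=> xi _; exact: mind_ge0.
  - exact: mind_meas.
  - by move=> xi _; rewrite lee_fin.
  - exact: pp_meas.
  by apply: eq_integral => xi _; exact: key.
have := split_int mu; rewrite !sq_err// e e -!sq_err// split_int !sq_err//.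
have := pp_fin mu m; have := pp_fin nu m.
move: (integral _ _ _) (integral _ _ _) => [p| |] [q| |]//= _ _.
by rewrite -!EFinD => -[] /addrI ->.
Qed.

Let ray_le mu nu (m : R) :
  (forall m, \int[mu]_xi (pp m xi)%:E = \int[nu]_xi (pp m xi)%:E)%E ->
  (mu `]m, +oo[%classic <= nu `]m, +oo[%classic)%E.
Proof.
move=> e.
have step (h : R) : 0 < h -> (mu `](m + h)%R, +oo[%classic <= nu `]m, +oo[%classic)%E.
  move=> h0.
  have ind_meas k : measurable_fun [set: T]
      (fun xi : R => (h * \1_`]k, +oo[%classic xi)%:E).
    apply/measurable_EFinP; apply: measurable_funM => //.
  have ind_int (la : P2 R) k :
      (\int[la]_xi (h * \1_`]k, +oo[%classic xi)%:E = h%:E * la `]k, +oo[%classic)%E.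
    under eq_integral do rewrite EFinM.
    rewrite ge0_integralZl_EFin//; last 2 first.
    - by apply/measurable_EFinP; exact: measurable_indic.
    - exact: ltW.
    by rewrite integral_indic ?setIT.
  have A : (\int[mu]_xi ((h * \1_`](m + h)%R, +oo[%classic xi)%:E + (pp (m + h)%R xi)%:E)
      <= \int[mu]_xi (pp m xi)%:E)%E.
    apply: ge0_le_integral => //.
    - by move=> xi _; rewrite lee_fin addr_ge0// mulr_ge0// ltW.
    - exact: emeasurable_funD.
    move=> xi _; rewrite lee_fin /pp indicE mem_setE in_itv/= andbT.
    by rewrite /Num.max; do 3 case: ltP => ? //=; lra.
  have B : (\int[nu]_xi (pp m xi)%:E <=
      \int[nu]_xi ((h * \1_`]m, +oo[%classic xi)%:E + (pp (m + h)%R xi)%:E))%E.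
    apply: ge0_le_integral; [exact: measurableT|by move=> xi _; rewrite lee_fin
      |exact: pp_meas|exact: emeasurable_funD|move=> xi _].
    rewrite lee_fin /pp indicE mem_setE in_itv/= andbT.
    by rewrite /Num.max; do 3 case: ltP => ? //=; lra.
  have split_int (la : P2 R) k : (\int[la]_xi
      ((h * \1_`]k, +oo[%classic xi)%:E + (pp (m + h)%R xi)%:E) =
      h%:E * la `]k, +oo[%classic + \int[la]_xi (pp (m + h)%R xi)%:E)%E.
    rewrite ge0_integralD ?ind_int//.
    - by move=> xi _; rewrite lee_fin mulr_ge0// ltW.
    - by move=> xi _; rewrite lee_fin.
  move: A B; rewrite !split_int !e => A B; have := le_trans A B.
  by rewrite leeD2rE ?pp_fin// lee_pmul2l.
have U : (`]m, +oo[%classic : set T) = \bigcup_n `](m + n.+1%:R^-1)%R, +oo[%classic.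
  apply/seteqP; split=> [xi|xi [n _]] /=; rewrite !in_itv/= !andbT => mxi.
    have [n hn] := ltr_add_invr mxi; exists n => //=.
    by rewrite in_itv/= andbT.
  by apply: lt_trans mxi; rewrite ltrDl.
rewrite {1}U.
have C : mu `](m + n.+1%:R^-1)%R, +oo[%classic @[n --> \oo] -->
    mu (\bigcup_n `](m + n.+1%:R^-1)%R, +oo[%classic).
  apply: (@nondecreasing_cvg_mu _ T R mu (fun n => `](m + n.+1%:R^-1)%R, +oo[%classic)).
  - by move=> i; exact: measurable_itv.
  - by apply: bigcup_measurable => i _; exact: measurable_itv.
  move=> i j ij; apply/subsetPset => xi /=; rewrite !in_itv/= !andbT.
  by apply: le_lt_trans; rewrite lerD2l lef_pV2 ?posrE// ler_nat ltnS.
rewrite -(cvg_lim _ C)//; apply: lime_le; first by apply/cvg_ex; eexists; exact: C.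
by apply: nearW => n; apply: step; rewrite invr_gt0.
Qed.

Lemma P2_eq mu nu : (forall A : set T, measurable A -> mu A = nu A) -> mu = nu.
Proof.
move=> h; have {}h : (P2_prob mu : set T -> \bar R) = P2_prob nu.
  apply/funext => A; have [mA|nA] := pselect (measurable A); first exact: h.
  by rewrite !P2_nonmeas.
case: mu nu h => [p pn pm] [q qn qm] /= h.
have {h} pq : p = q.
  case: p q h {pn pm qn qm} => [p cp] [q cq] /= pq; subst q; congr Probability.Pack.
  case: cp cq => [[a b] [c] [d] [e] [f] [g] [h]] [[a' b'] [c'] [d'] [e'] [f'] [g'] [h']].
  have ? : a' = a by exact: Prop_irrelevance.
  have ? : b' = b by exact: Prop_irrelevance.
  subst a' b'; congr Probability.Class; congr (_ _); exact: Prop_irrelevance.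
by subst q; congr MkP2; exact: Prop_irrelevance.
Qed.

Lemma quant_dist_eq0 N mu nu : (1 < N)%N -> quant_dist N mu nu = 0 -> mu = nu.
Proof.
move=> N1 d0; have e (x : 'rV[R]_N) : quant_err mu x = quant_err nu x :> R.
  have := quant_dist_ub mu nu x (ltnW N1).
  by rewrite d0 normr_le0 subr_eq0 => /eqP.
have ray m : mu `]m, +oo[%classic = nu `]m, +oo[%classic.
  by apply/eqP; rewrite eq_le; apply/andP; split; apply: ray_le => k;
    apply: pp_eq N1 _.
apply: P2_eq => A mA.
apply: (@measure_unique _ R T (@RGenOInfty.G R) (fun k => `]- k%:R, +oo[%classic)
  (RGenOInfty.measurableE R) _ _ _ (P2_prob mu) (P2_prob nu)) => //.
- move=> _ _ [x ->] [y ->]; exists (Num.max x y).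
  apply/seteqP; split=> xi /=; rewrite !in_itv/= !andbT gt_max.
    by move=> [-> ->].
  by move=> /andP.
- by move=> k; exists (- k%:R).
- apply/seteqP; split=> // xi _; exists (Num.truncn `|xi|).+1 => //=.
  rewrite in_itv/= andbT ltrNl; apply: le_lt_trans (truncnS_gt _).
  by rewrite -normrN ler_norm.
- by move=> _ [x ->]; exact: ray.
- by move=> k; rewrite (le_lt_trans (probability_le1 (P2_prob mu) _)) ?ltry.
Qed.

End facts.

(* The alias carries [N] and [1 < N], so that each metric [quant_dist N] gets
   its own canonical structure on [P2 R]. *)
Definition P2_space (R : realType) (N : nat) (N_gt1 : (1 < N)%N) : Type := P2 R.

HB.instance Definition _ (R : realType) (N : nat) (N_gt1 : (1 < N)%N) :=
  gen_eqMixin (P2_space R N_gt1).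
HB.instance Definition _ (R : realType) (N : nat) (N_gt1 : (1 < N)%N) :=
  gen_choiceMixin (P2_space R N_gt1).
HB.instance Definition _ (R : realType) (N : nat) (N_gt1 : (1 < N)%N) :=
  isMetric.Build R (P2_space R N_gt1) (@quant_distxx R N)
    (fun mu nu => @quant_dist_eq0 R N mu nu N_gt1) (@quant_dist_sym R N)
    (@quant_dist_triangle R N (ltnW N_gt1)).

Lemma mdist_P2E (R : realType) (N : nat) (N_gt1 : (1 < N)%N)
  (mu nu : P2_space R N_gt1) : mdist mu nu = quant_dist N mu nu.
Proof. by []. Qed.

(* Main.v *)
(* Put mass [1 / ((n+1) 4^k)] at [2^k] for [1 <= k <= n+1] and the remaining mass
   at [0].  The escaping part has second moment [1] and vanishing mass and mean.
   Since that moment is shared equally between [n+1] dyadic scales and [N]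
   centers can reduce it on boundedly many scales only, the squared quantization
   error tends to [r^2 + 1], where [r] is the distance from [0] to the centers,
   fast enough to make the convergence of the errors uniform in the centers.
   A limit would have second moment [1] (all centers at [0]), unchanged when
   centers are added at any [b]; so almost surely no [b = +-1/(m+1)] is closer
   than [0], which forces the Dirac mass at [0]. *)
Require Import Defs.
From mathcomp Require Import all_boot all_order all_algebra.
From mathcomp Require Import all_classical all_reals all_analysis.
From HB Require Import structures.
From mathcomp Require Import ring lra measurable_realfun.
Import Order.TTheory GRing.Theory Num.Theory.
Import numFieldNormedType.Exports.
Local Open Scope classical_set_scope.
Local Open Scope ring_scope.

(** * Dyadic sums of a bump *)

(** The bump vanishes for [u >= 2] and is at most [2 * u] below, so along dyadic scales it sums to a
    constant free of [s] and [n]. This is what limits the effect of a single center over all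
    scales. *)
Lemma telescoping_bump_sum (R : realFieldType) (s : R) (n : nat) : 0 <= s ->
  \sum_(k < n) (let u := s / 2 ^+ k.+1 in u * Num.max (2 - u) 0) <= 8.
Proof.
move=> s0.
(* With [G u = min (4 u) 8], each term is at most [G u - G (u / 2)]. *)
suff : \sum_(k < n) (let u := s / 2 ^+ k.+1 in u * Num.max (2 - u) 0)
    + Num.min (4 * (s / 2 ^+ n.+1)) 8 <= 8.
  have : 0 <= Num.min (4 * (s / 2 ^+ n.+1)) 8.
    by rewrite le_min ler0n andbT mulr_ge0// divr_ge0// exprn_ge0.
  lra.
elim: n => [|n IH]; first by rewrite big_ord0 add0r ge_min lexx orbT.
apply: le_trans IH; rewrite big_ord_recr/= -addrA lerD2l.
set u := s / 2 ^+ n.+1; have -> : s / 2 ^+ n.+2 = u / 2.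
  by rewrite /u exprSr invfM mulrA.
have u0 : 0 <= u by rewrite divr_ge0// exprn_ge0.
rewrite !minElt maxElt; case: ifPn => h1; case: ifPn => h2; case: ifPn => h3;
  move: h1 h2 h3; rewrite -?leNgt; nra.
Qed.

(** * Squared distance to the centers *)

(** The integrand of [quant_err] as a real number. The minimum is finite when [0 < N]; for [N = 0]
    it is [+oo], which [fine] sends to [0]. *)
Definition sqdist {R : realType} {N : nat} (x : 'rV[R]_N) (t : R) : R :=
  fine (\big[Order.min/+oo%E]_(i < N) ((`|t - x 0 i| ^+ 2)%:E)).

Lemma sqdist_attained {R : realType} {N : nat} (x : 'rV[R]_N) (t : R) :
  (0 < N)%N -> exists i, sqdist x t = (t - x 0 i) ^+ 2 /\
    \big[Order.min/+oo%E]_(i < N) ((`|t - x 0 i| ^+ 2)%:E)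
      = ((t - x 0 i) ^+ 2)%:E.
Proof.
rewrite /sqdist; case: N x => // n x _.
have [i _|i _ ->] :=
  @eq_bigmin _ _ _ +oo%E ord0 xpredT (fun i => (`|t - x 0 i| ^+ 2)%:E) isT.
  by rewrite leey.
by exists i; rewrite real_normK ?num_real.
Qed.

Lemma sqdistE {R : realType} {N : nat} (x : 'rV[R]_N) (t : R) : (0 < N)%N ->
  \big[Order.min/+oo%E]_(i < N) ((`|t - x 0 i| ^+ 2)%:E) = (sqdist x t)%:E.
Proof. by move=> /(sqdist_attained x t)[i [-> ->]]. Qed.

Lemma sqdist_le {R : realType} {N : nat} (x : 'rV[R]_N) (t : R) (i : 'I_N) :
  sqdist x t <= (t - x 0 i) ^+ 2.
Proof.
rewrite -lee_fin -sqdistE ?(leq_trans _ (ltn_ord i))//.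
by rewrite -(real_normK (num_real (t - _))) (bigD1 i)//= ge_min lexx.
Qed.

Lemma sqdist_ge0 {R : realType} {N : nat} (x : 'rV[R]_N) (t : R) :
  (0 < N)%N -> 0 <= sqdist x t.
Proof. by move=> /(sqdist_attained x t)[i [-> _]]; exact: sqr_ge0. Qed.

Lemma measurable_sqdist {R : realType} {N : nat} (x : 'rV[R]_N) :
  (0 < N)%N -> measurable_fun [set: measurableTypeR R] (sqdist x).
Proof.
move=> N0; apply/measurable_EFinP; rewrite /comp.
under eq_fun do rewrite -sqdistE//.
suff H (s : seq 'I_N) : measurable_fun [set: measurableTypeR R] (fun t : R =>
  \big[Order.min/+oo%E]_(i <- s) ((`|t - x 0 i| ^+ 2)%:E)) by exact: H.
elim: s => [|i s IH].
  by under eq_fun do rewrite big_nil; exact: measurable_cst.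
under eq_fun do rewrite big_cons.
apply: measurable_mine => //; apply/measurable_EFinP.
apply: measurable_funX; apply: measurableT_comp => //.
exact: measurable_funB.
Qed.

Lemma quant_errE {R : realType} {N : nat} (mu : P2 R) (x : 'rV[R]_N) :
  (0 < N)%N ->
  quant_err mu x = Num.sqrt (fine (\int[mu]_xi (sqdist x xi)%:E)).
Proof.
by move=> N0; congr (Num.sqrt (fine _)); apply: eq_integral => t _; rewrite sqdistE.
Qed.

(** The center nearest to [0] serves [t] at cost [r ^+ 2 + t ^+ 2] up to the cross term [2 * r * t].
    A center further out can undercut this range only if its excess [|x 0 i| - r] is below
    [2 * t]. *)
Lemma sqdist_near_sum {R : realType} {N : nat} (x : 'rV[R]_N) (t r : R) :
  (0 < N)%N -> 0 <= t -> r = Num.sqrt (sqdist x 0) ->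
  `|sqdist x t - (r ^+ 2 + t ^+ 2)| <= 2 * r * t +
    \sum_i (`|x 0 i| - r) * Num.max (2 * t - (`|x 0 i| - r)) 0.
Proof.
move=> N0 t0 rdef; have r0 : 0 <= r by rewrite rdef; exact: sqrtr_ge0.
have rE : r ^+ 2 = sqdist x 0 by rewrite rdef sqr_sqrtr// sqdist_ge0.
have rx i : r <= `|x 0 i|.
  rewrite -(@ler_pXn2r _ 2)// ?nnegrE// rE.
  by rewrite real_normK ?num_real// (le_trans (sqdist_le x 0 i))// sub0r sqrrN.
pose F i := (`|x 0 i| - r) * Num.max (2 * t - (`|x 0 i| - r)) 0.
have F0 i : 0 <= F i by rewrite mulr_ge0 ?subr_ge0// le_max lexx orbT.
have S0 : 0 <= \sum_i F i by exact: sumr_ge0.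
rewrite ler_norml; apply/andP; split.
  (* Lower bound, from the center nearest to [t]: its own bump term [F j] absorbs the gain. *)
  have [j [-> _]] := sqdist_attained x t N0.
  have Fj : F j <= \sum_i F i by rewrite (bigD1 j)//= lerDl sumr_ge0.
  suff : 2 * t * x 0 j - x 0 j ^+ 2 + r ^+ 2 <= 2 * r * t + F j.
    rewrite -/(\sum_i F i); lra.
  rewrite -(real_normK (num_real (x 0 j))).
  have := rx j; rewrite /F; set y := `|x 0 j| => ry.
  have xy : x 0 j <= y by exact: ler_norm.
  have : (y - r) * (2 * t - (y - r)) <= (y - r) * Num.max (2 * t - (y - r)) 0.
    by rewrite ler_wpM2l ?subr_ge0// le_max lexx.
  have := ler_wpM2l t0 xy; have := mulr_ge0 r0 (_ : 0 <= y - r).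
  rewrite subr_ge0 => /(_ ry); set M := (y - r) * Num.max _ _; nra.
(* Upper bound, from the center nearest to [0], for which [|x 0 j| = r]. *)
have [j [E _]] := sqdist_attained x 0 N0.
have rj : r = `|x 0 j| by rewrite rdef E sub0r sqrrN sqrtr_sqr.
have := sqdist_le x t j.
have : - r <= x 0 j by rewrite rj lerNl -normrN ler_norm.
move=> /(ler_wpM2l t0).
have <- : x 0 j ^+ 2 = r ^+ 2 by rewrite rj real_normK ?num_real.
rewrite -/F in S0 *; nra.
Qed.

(** * Discrete members of [P2] *)

(* A [P2] must vanish off the Borel sets, which an arbitrary [probability] need
   not do. *)
Definition borel_part {R : realType} (p : probability (measurableTypeR R) R)
    (A : set (measurableTypeR R)) : \bar R :=
  if pselect (measurable A) then p A else 0%E.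

Lemma borel_partE {R : realType} (p : probability (measurableTypeR R) R)
  (A : set (measurableTypeR R)) : measurable A -> borel_part p A = p A.
Proof. by move=> mA; rewrite /borel_part; case: pselect. Qed.

Lemma borel_part0 {R : realType} (p : probability (measurableTypeR R) R) :
  borel_part p set0 = 0%E.
Proof. by rewrite borel_partE ?measure0. Qed.

Lemma borel_part_ge0 {R : realType} (p : probability (measurableTypeR R) R)
  (A : set (measurableTypeR R)) : (0 <= borel_part p A)%E.
Proof. by rewrite /borel_part; case: pselect => [mA|nA] /=. Qed.

Lemma borel_part_sigma_additive {R : realType}
  (p : probability (measurableTypeR R) R) : semi_sigma_additive (borel_part p).
Proof.
move=> F mF tF mUF; rewrite borel_partE//.
under eq_fun do under eq_bigr do rewrite borel_partE//.
exact: measure_semi_sigma_additive.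
Qed.

Lemma borel_partT {R : realType} (p : probability (measurableTypeR R) R) :
  borel_part p [set: measurableTypeR R] = 1%E.
Proof. by rewrite borel_partE// probability_setT. Qed.

HB.instance Definition _ (R : realType)
    (p : probability (measurableTypeR R) R) :=
  isMeasure.Build _ _ _ (borel_part p)
    (borel_part0 p) (borel_part_ge0 p) (borel_part_sigma_additive p).

HB.instance Definition _ (R : realType)
    (p : probability (measurableTypeR R) R) :=
  Measure_isProbability.Build _ _ _ (borel_part p) (borel_partT p).

(** Integrals see a measure only through its values on Borel sets, so passing to [borel_part p]
    changes none of them. *)
Lemma P2_of_probability {R : realType}
  (p : probability (measurableTypeR R) R) :
  (\int[p]_xi (xi ^+ 2)%:E < +oo)%E ->
  exists mu : P2 R, forall f : R -> \bar R,
    (\int[mu]_xi f xi = \int[p]_xi f xi)%E.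
Proof.
have E (f : R -> \bar R) :
    (\int[borel_part p]_xi f xi = \int[p]_xi f xi)%E.
  by apply: eq_measure_integral => A mA _; exact: borel_partE.
move=> p2; unshelve eexists (@MkP2 R (borel_part p) _ _).
- by move=> A nA; rewrite /= /borel_part; case: pselect.
- by rewrite E.
- by move=> f; exact: E.
Qed.

Lemma P2_discrete {R : realType} (n : nat) (w t : nat -> R) :
  (forall k, 0 <= w k) -> \sum_(k < n) w k = 1 ->
  exists mu : P2 R, forall f : R -> R,
    measurable_fun [set: measurableTypeR R] f -> (forall x, 0 <= f x) ->
    (\int[mu]_xi (f xi)%:E = (\sum_(k < n) w k * f (t k))%:E)%E.
Proof.
move=> w0 w1.
pose D k : {measure set (measurableTypeR R) -> \bar R} :=
  mscale (NngNum (w0 k)) (\d_(t k : measurableTypeR R)).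
(* [mnormalize] supplies the probability structure. The total mass is already [1], so the measure is
   unchanged; the Dirac mass is the default for total mass [0] or [+oo]. *)
pose p : probability (measurableTypeR R) R :=
  mnormalize (msum D n) \d_(0 : measurableTypeR R).
have mT : msum D n [set: measurableTypeR R] = 1%E.
  rewrite /msum/= /mscale/= -[RHS]/(1%R%:E) -w1 -sumEFin.
  by apply: eq_bigr => k _; rewrite diracT mule1.
have pE A : p A = msum D n A.
  rewrite /p/= /mnormalize/= mT ifF ?invr1 ?mule1//.
  by rewrite gt_eqF//= ?lte01.
have int_p (f : R -> R) :
    measurable_fun [set: measurableTypeR R] f -> (forall x, 0 <= f x) ->
    (\int[p]_xi (f xi)%:E = (\sum_(k < n) w k * f (t k))%:E)%E.
  move=> mf f0; have mEf := (measurable_EFinP _ f).2 mf.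
  rewrite (@eq_measure_integral _ _ _ _ (msum D n)); last first.
    by move=> A _ _; exact: pE.
  rewrite ge0_integral_measure_sum//; last by move=> x _; rewrite lee_fin.
  rewrite -sumEFin; apply: eq_bigr => k _.
  rewrite ge0_integral_mscale//; last by move=> x _; rewrite lee_fin.
  by rewrite integral_dirac// diracT mul1e EFinM.
have [|mu muE] := @P2_of_probability R p.
  rewrite int_p ?ltry//; last by move=> x; exact: sqr_ge0.
by exists mu => f mf f0; rewrite muE int_p.
Qed.

(** * The spreading sequence and its uniform rate *)

Lemma sum_halves_le {R : realFieldType} (n : nat) :
  \sum_(k < n) (2 ^+ k.+1)^-1 <= 1 :> R.
Proof.
suff -> : \sum_(k < n) (2 ^+ k.+1)^-1 = 1 - (2 ^+ n)^-1 :> R.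
  by rewrite gerBl invr_ge0 exprn_ge0.
elim: n => [|n IH]; first by rewrite big_ord0 expr0 invr1 subrr.
rewrite big_ord_recr/= IH exprS invfM.
by field; rewrite expf_neq0//= pnatr_eq0.
Qed.

(** Write [|e - F| * (e + F) = |e ^+ 2 - F ^+ 2|] and use [1 + r <= 2 * F]. An error on the squares
    that grows linearly in [r] thus becomes uniform in [r]. *)
Lemma dist_sqrt_le {R : rcfType} (a r C : R) :
  0 <= a -> 0 <= r -> `|a - (r ^+ 2 + 1)| <= C * (1 + r) ->
  `|Num.sqrt a - Num.sqrt (r ^+ 2 + 1)| <= 2 * C.
Proof.
move=> a0 r0 h; set e := Num.sqrt a; set F := Num.sqrt (r ^+ 2 + 1).
have r20 : 0 <= r ^+ 2 by exact: sqr_ge0.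
have e0 : 0 <= e by exact: sqrtr_ge0.
have F0 : 0 <= F by exact: sqrtr_ge0.
have eE : e ^+ 2 = a by rewrite sqr_sqrtr.
have FE : F ^+ 2 = r ^+ 2 + 1 by rewrite sqr_sqrtr// addr_ge0.
have F1 : 1 <= F by rewrite -(@ler_pXn2r _ 2)// ?nnegrE// FE expr1n lerDr.
have Fr : r <= F by rewrite -(@ler_pXn2r _ 2)// ?nnegrE// FE lerDl.
have C0 : 0 <= C.
  by have := le_trans (normr_ge0 _) h; rewrite pmulr_lge0//; lra.
have eF : 0 < e + F by lra.
have E : `|e - F| * (e + F) = `|a - (r ^+ 2 + 1)|.
  by rewrite -eE -FE subr_sqr normrM (ger0_norm (ltW eF)).
rewrite -(ler_pM2r eF) E; apply: le_trans h _.
nra.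
Qed.

Definition spread_weight {R : realType} (n k : nat) : R :=
  if k is k'.+1 then n.+1%:R^-1 / (2 ^+ k) ^+ 2
  else 1 - \sum_(i < n.+1) n.+1%:R^-1 / (2 ^+ i.+1) ^+ 2.

(** Index [0] is set apart because [2 ^+ 0] is [1], not the origin. *)
Definition spread_atom {R : realType} (k : nat) : R :=
  if k is 0 then 0 else 2 ^+ k.

Lemma spread_weight_ge0 {R : realType} (n k : nat) :
  0 <= spread_weight n k :> R.
Proof.
case: k => [|k] /=; last by rewrite divr_ge0// ?sqr_ge0// invr_ge0.
rewrite subr_ge0; apply: le_trans (sum_halves_le n.+1).
apply: ler_sum => i _.
have p0 : 0 < (2 ^+ i.+1 : R) by rewrite exprn_gt0.
have p1 : 1 <= (2 ^+ i.+1 : R) by rewrite exprn_ege1// ler1n.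
have c1 : n.+1%:R^-1 <= 1 :> R by rewrite invf_le1// ler1n.
rewrite -[leRHS]mul1r ler_pM// ?invr_ge0// ?sqr_ge0//.
by rewrite lef_pV2 ?posrE ?exprn_gt0// expr2 ler_peMl// ltW.
Qed.

Lemma spread_weight_sum {R : realType} (n : nat) :
  \sum_(k < n.+2) spread_weight n k = 1 :> R.
Proof. by rewrite big_ord_recl/= subrK. Qed.

Lemma spread_quant_err {R : realType} {N : nat} (mu : P2 R) (n : nat)
  (x : 'rV[R]_N) : (0 < N)%N ->
  (forall f : R -> R, measurable_fun [set: measurableTypeR R] f ->
    (forall t, 0 <= f t) -> (\int[mu]_xi (f xi)%:E =
      (\sum_(k < n.+2) spread_weight n k * f (spread_atom k))%:E)%E) ->
  `|quant_err mu x - Num.sqrt (sqdist x 0 + 1)| <= 16 * N%:R / n.+1%:R.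
Proof.
move=> N0 muE; rewrite quant_errE// muE; [|exact: measurable_sqdist|
  by move=> t; exact: sqdist_ge0].
rewrite [fine _]/=; set r : R := Num.sqrt (sqdist x 0).
have r0 : 0 <= r by exact: sqrtr_ge0.
have rE : sqdist x 0 = r ^+ 2 by rewrite sqr_sqrtr// sqdist_ge0.
have N1 : 1 <= N%:R :> R by rewrite ler1n.
pose c : R := n.+1%:R^-1; have c0 : 0 < c by rewrite invr_gt0.
(* The [8] is the bound of [telescoping_bump_sum], once per center; the [2] is the loss in
   [dist_sqrt_le]. *)
rewrite rE (_ : 16 * N%:R / n.+1%:R = 2 * (8 * N%:R * c)); last first.
  by rewrite /c; ring.
apply: dist_sqrt_le => //.
  by apply: sumr_ge0 => k _; rewrite mulr_ge0 ?spread_weight_ge0// sqdist_ge0.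
(* The weights sum to [1], and each of the [n.+1] nonzero atoms adds [n.+1%:R^-1] to the second
   moment. *)
have -> : r ^+ 2 + 1 = \sum_(k < n.+2) spread_weight n k *
    (r ^+ 2 + spread_atom k ^+ 2).
  under eq_bigr do rewrite mulrDr.
  rewrite big_split/= -mulr_suml spread_weight_sum mul1r big_ord_recl/=.
  rewrite expr0n/= mulr0 add0r; congr (_ + _).
  under eq_bigr => i _ do rewrite divfK ?expf_neq0// ?pnatr_eq0//.
  by rewrite sumr_const card_ord -[RHS]mulr_natr mulVf// pnatr_eq0.
(* The atom at [0] cancels exactly, since [sqdist x 0 = r ^+ 2]. *)
rewrite -sumrB big_ord_recl/= rE expr0n/= addr0 subrr add0r.
pose s i : R := `|x 0 i| - r.
pose u i k : R := s i / 2 ^+ k.+1.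
(* [sqdist_near_sum] at the atom [t], divided by [t ^+ 2]: only the ratios [u i k] of excess to
   scale remain. *)
apply: (@le_trans _ _ (\sum_(k < n.+1) c *
    (2 * r * (2 ^+ k.+1)^-1 + \sum_(i < N) u i k * Num.max (2 - u i k) 0))).
  apply: le_trans (ler_norm_sum _ _ _) _; apply: ler_sum => k _.
  rewrite -mulrBr; set t : R := 2 ^+ k.+1.
  have t0 : 0 < t by rewrite exprn_gt0.
  have w0 : 0 <= n.+1%:R^-1 / t ^+ 2 by rewrite divr_ge0// ?sqr_ge0// invr_ge0.
  rewrite normrM (ger0_norm w0) -/c -[leLHS]mulrA; apply: (ler_wpM2l (ltW c0)).
  rewrite [leLHS]mulrC ler_pdivrMr ?exprn_gt0// [leRHS]mulrC.
  apply: le_trans (sqdist_near_sum x t r N0 (ltW t0) erefl) _.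
  rewrite -/r mulrDr lerD//.
    by rewrite (_ : t ^+ 2 * _ = 2 * r * t)//; field; rewrite gt_eqF.
  rewrite mulr_sumr; apply: ler_sum => i _.
  rewrite -/(s i) (_ : t ^+ 2 * _ = t * u i k * (t * Num.max (2 - u i k) 0));
    last by ring.
  rewrite [t * Num.max _ _](maxr_pMr _ _ (ltW t0)) mulr0 mulrBr.
  rewrite /u -/t.
  by rewrite [t * (_ / t)]mulrC divfK ?gt_eqF// [t * 2]mulrC lexx.
(* With the sums exchanged, each center has its own dyadic sum over the scales. *)
rewrite -mulr_sumr big_split/= -mulr_sumr exchange_big/=.
have A := ler_wpM2l r0 (@sum_halves_le R n.+1).
have B : \sum_(i < N) \sum_(k < n.+1) u i k * Num.max (2 - u i k) 0 <= 8 * N%:R.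
  rewrite (_ : 8 * N%:R = \sum_(i < N) 8); last first.
    by rewrite sumr_const card_ord mulr_natr.
  apply: ler_sum => i _; apply: telescoping_bump_sum; rewrite /s subr_ge0 /r.
  rewrite -[leRHS]sqrtr_sqr ler_sqrt ?sqr_ge0// -(sqrrN (x _ _)) -[- _]sub0r.
  exact: sqdist_le.
rewrite (_ : 8 * N%:R * c * (1 + r) = c * (8 * N%:R * (1 + r))); last by ring.
apply: (ler_wpM2l (ltW c0)); rewrite -[2 * r * _]mulrA; nra.
Qed.

(** * Excluding the limit *)

Lemma no_escaping_moment_limit {R : realType} {N : nat} (nu : P2 R) :
  (1 < N)%N ->
  ~ (forall x : 'rV[R]_N, quant_err nu x = Num.sqrt (sqdist x 0 + 1)).
Proof.
move=> N1 nuE; have N0 : (0 < N)%N by exact: ltnW.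
have int1 (x : 'rV[R]_N) : sqdist x 0 = 0 ->
    (\int[nu]_xi (sqdist x xi)%:E = 1%:E)%E.
  move=> x0; have := nuE x; rewrite quant_errE// x0 add0r sqrtr1.
  have : (0 <= \int[nu]_xi (sqdist x xi)%:E)%E.
    by apply: integral_ge0 => t _; rewrite lee_fin sqdist_ge0.
  (* An infinite integral is excluded too: [fine +oo = 0] would give error [0] instead of [1]. *)
  case: (\int[nu]_xi _)%E => [a| |]; last by rewrite leeNy_eq.
    rewrite lee_fin /= => a0 /(congr1 (fun z => z ^+ 2)).
    by rewrite sqr_sqrtr// expr1n => ->.
  by move=> _ /eqP; rewrite /= sqrtr0 eq_sym oner_eq0.
have sq0 t : sqdist (0 : 'rV[R]_N) t = t ^+ 2.
  by have [i [-> _]] := sqdist_attained (0 : 'rV[R]_N) t N0; rewrite mxE subr0.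
have mom : (\int[nu]_xi (xi ^+ 2)%:E = 1%:E)%E.
  rewrite -(int1 0) ?sq0 ?expr0n//.
  by apply: eq_integral => t _; rewrite sq0.
have msq : measurable_fun [set: measurableTypeR R] (fun t : R => t ^+ 2).
  exact: measurable_funX.
have closer (b : R) : {ae (P2_prob nu : measure _ _),
    forall t : measurableTypeR R, (t : R) ^+ 2 <= (t - b) ^+ 2}.
  (* One center at [0] and all others at [b], which takes [1 < N]. *)
  pose x : 'rV[R]_N := \row_i (if i == Ordinal N0 then 0 else b).
  have le1 t : sqdist x t <= t ^+ 2.
    by have := sqdist_le x t (Ordinal N0); rewrite mxE eqxx subr0.
  have le2 t : sqdist x t <= (t - b) ^+ 2.
    by have := sqdist_le x t (Ordinal N1); rewrite mxE.
  have x0 : sqdist x 0 = 0.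
    by apply/eqP; rewrite eq_le sqdist_ge0// andbT; have := le1 0; rewrite expr0n.
  have mD : measurable_fun [set: measurableTypeR R]
      (fun t : R => (t ^+ 2 - sqdist x t)%:E).
    by apply/measurable_EFinP; apply: measurable_funB => //;
      exact: measurable_sqdist.
  (* Both integrals equal [1], so the nonnegative difference integrates to [0] and vanishes almost
     everywhere. *)
  have D0 : (\int[nu]_t (t ^+ 2 - sqdist x t)%:E = 0)%E.
    have : (\int[nu]_t (t ^+ 2)%:E =
        \int[nu]_t (t ^+ 2 - sqdist x t)%:E + \int[nu]_t (sqdist x t)%:E)%E.
      rewrite -ge0_integralD//; last 3 first.
      - by move=> t _; rewrite lee_fin subr_ge0.
      - by move=> t _; rewrite lee_fin sqdist_ge0.
      - by apply/measurable_EFinP; exact: measurable_sqdist.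
      by apply: eq_integral => t _; rewrite -EFinD subrK.
    rewrite mom int1//.
    case: (\int[nu]_t (_ - _)%:E)%E => [a| |] //=; rewrite -EFinD => -[].
    by move=> /eqP; rewrite eq_sym -subr_eq0 addrK => /eqP ->.
  have /(ae_eq_integral_abs _ measurableT mD).1 :
      (\int[nu]_t `|(t ^+ 2 - sqdist x t)%:E| = 0)%E.
    rewrite -[RHS]D0; apply: eq_integral => t _.
    by rewrite gee0_abs// lee_fin subr_ge0.
  apply: filterS => t /(_ I) [] /eqP; rewrite subr_eq0 => /eqP ->.
  exact: le2.
(* Countably many [b] share one null set. *)
have : {ae (P2_prob nu : measure _ _), forall t : measurableTypeR R, forall m,
    (t : R) ^+ 2 <= (t - m.+1%:R^-1) ^+ 2 /\
    (t : R) ^+ 2 <= (t + m.+1%:R^-1) ^+ 2}.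
  apply/ae_foralln => m.
  apply: filterS2 (closer m.+1%:R^-1) (closer (- m.+1%:R^-1)) => t h1 h2.
  by split=> //; rewrite -[_^-1]opprK.
move=> ae0.
suff : (\int[nu]_t (t ^+ 2)%:E = 0)%E
  by rewrite mom => -[] /eqP; rewrite oner_eq0.
have -> : (\int[nu]_t (t ^+ 2)%:E = \int[nu]_t `|(t ^+ 2)%:E|)%E.
  by apply: eq_integral => t _; rewrite gee0_abs// lee_fin sqr_ge0.
apply/ae_eq_integral_abs => //; first by apply/measurable_EFinP.
apply: filterS ae0 => t h _; congr EFin; apply/eqP; rewrite sqrf_eq0.
apply/negPn/negP => t0.
(* If [1/(m+1) < |t|], whichever of [1/(m+1)] and [-1/(m+1)] has the sign of [t] is strictly closer
   to [t] than [0] is. *)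
have at0 : 0 < `|t : R| by rewrite normr_gt0.
have [m] := ltr_add_invr at0; rewrite add0r.
have : 0 < m.+1%:R^-1 :> R by rewrite invr_gt0.
have [] := h m; move: (m.+1%:R^-1) (t : R) at0 => d y y0 h1 h2 d0 dy.
have := mulr_gt0 d0 y0; have : 0 < d * (`|y| - d) by rewrite mulr_gt0// subr_gt0.
move: h1 h2; case: (ger0P y) => _; nra.
Qed.

(** * A Cauchy sequence without limit *)

Theorem theorem4p1 (R : realType) (N : nat) (N_gt1 : (1 < N)%N) :
  ~ (forall mu : nat -> P2_space R N_gt1,
       cauchy (mu n @[n --> \oo]) ->
       exists nu : P2_space R N_gt1, mu n @[n --> \oo] --> nu).
Proof.
move=> complete; have N0 : (0 < N)%N by exact: ltnW.
have [mu muE] := @choice nat (P2 R) _ (fun n => @P2_discrete R n.+2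
  (spread_weight n) spread_atom (spread_weight_ge0 n) (spread_weight_sum n)).
have rate n (x : 'rV[R]_N) := @spread_quant_err R N (mu n) n x N0 (muE n).
have small (e : R) : 0 < e ->
    exists n0, forall n, (n0 <= n)%N -> 16 * N%:R / n.+1%:R < e.
  move=> e0; exists (Num.truncn (16 * N%:R / e)) => n hn.
  rewrite ltr_pdivrMr// [ltRHS]mulrC -ltr_pdivrMr//.
  by apply: lt_le_trans (truncnS_gt _) _; rewrite ler_nat ltnS.
have [|nu munu] := complete (fun n => mu n : P2_space R N_gt1).
  apply/cauchy_exP => e e0; have e2 : 0 < e / 2 by rewrite divr_gt0.
  have [n0 hn0] := small _ e2.
  exists (mu n0 : P2_space R N_gt1); exists n0 => // n /= n0n.
  rewrite ballEmdist/= mdist_P2E.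
  apply: (@le_lt_trans _ _ (16 * N%:R / n0.+1%:R + 16 * N%:R / n.+1%:R)).
    (* Both errors are compared with their common limit at [x]; the rate does not depend on [x]. *)
    apply: quant_dist_le => x.
    apply: le_trans (ler_distD (Num.sqrt (sqdist x 0 + 1)) _ _) _.
    by rewrite lerD// distrC.
  by rewrite [ltRHS]splitr ltrD// hn0.
(* Convergence in [quant_dist] forces the errors of [nu] to be the pointwise limits of those of
   [mu n]. *)
apply: (@no_escaping_moment_limit R N nu N_gt1) => x.
apply/eqP; rewrite -subr_eq0 -normr_le0; apply/ler_addgt0Pl => e e0.
rewrite addr0; have e2 : 0 < e / 2 by rewrite divr_gt0.
have [n0 hn0] := small (e / 2) e2.
have /cvg_ballP /(_ _ e2) [n1 _ hn1] := munu.
pose n := maxn n0 n1.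
have := hn1 n (leq_maxr _ _); rewrite /= ballEmdist/= mdist_P2E => h1.
have := hn0 n (leq_maxl _ _) => h2.
apply: le_trans (ler_distD (quant_err (mu n) x) _ _) _.
rewrite [leRHS]splitr lerD//.
  exact: le_trans (quant_dist_ub _ _ _ N0) (ltW h1).
exact: le_trans (rate n x) (ltW h2).
Qed.
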